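(* Let $N\ge 0$, let $B_0,\dots,B_N$ be complex $m\times m$ matrices, let $b_0=0$ and $b_1,\dots,b_N\in\mathbb{C}$, let $\lambda\in\mathbb{C}$, and let $K_\lambda(x,s)$ be a function satisfying $$q^{\lambda}K_\lambda(qx,s)=K_\lambda(x,s/q)=\frac{x-q^{\lambda}s}{x-s}K_\lambda(x,s).$$ Let $Y(x)$ be a $\mathbb{C}^m$-valued solution to $$\frac{Y(qx)-Y(x)}{-x}=\Biggl[\sum_{i=0}^{N}\frac{B_i}{x-b_i}\Biggr]Y(x),$$ and set $$\widetilde Y_i(x)=\int_0^{\xi\infty}\frac{K_\lambda(x,s)}{s-b_i}Y(s)\,{\rm d}_qs\quad(i=0,\dots,N),\qquad \widetilde Y(x)=\begin{pmatrix}\widetilde Y_0(x)\\ \vdots\\ \widetilde Y_N(x)\end{pmatrix}.$$ Assume that the variable $\xi$ is independent of $x$ or that it is proportional to $x$ (i.e. $\xi=Ax$ where $A$ is independent of $x$). If every element of $\widetilde Y_i(x)$ converges for $i=0,1,\dots,N$ and $$\lim_{K\to-\infty}K_\lambda\bigl(x,q^{K-1}\xi\bigr)Y\bigl(q^{K}\xi\bigr)=0,\qquad \lim_{L\to+\infty}K_\lambda\bigl(x,q^{L}\xi\bigr)Y\bigl(q^{L+1}\xi\bigr)=0,$$ then the function $\widetilde Y(x)$ satisfies $$\frac{\widetilde Y(qx)-\widetilde Y(x)}{-x}=\Biggl[\sum_{i=0}^{N}\frac{G_i}{x-b_i}\Biggr]\widetilde Y(x),$$ where $(G_0,\dots,G_N)$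 is the $q$-convolution with parameter $\lambda$ of $(B_0,\dots,B_N)$.
   Context: Throughout, $q\in\mathbb{C}$ with $0<|q|<1$; a value of $\log q$ is fixed and $q^{a}=\exp(a\log q)$. Jackson integral: for $\xi\in\mathbb{C}\setminus\{0\}$, $\int_0^{\xi\infty}f(s)\,{\rm d}_qs=(1-q)\sum_{n=-\infty}^{\infty}q^n\xi f(q^n\xi)$ (applied componentwise to vector-valued functions). Convergence means convergence of the partial sums over $K\le n\le L$ as $K\to-\infty$ and $L\to+\infty$. $q$-convolution: given $m\times m$ matrices $B_0,\dots,B_N$ and $\lambda\in\mathbb{C}$, the $q$-convolution is the tuple $(G_0,\dots,G_N)$ of $(N+1)m\times(N+1)m$ matrices, where $G_i$, viewed as an $(N+1)\times(N+1)$ array of $m\times m$ blocks with rows and columns indexed by $0,\dots,N$, has all block rows zero except row $i$, and its $(i,j)$ block is $q^{-\lambda}B_j$ for $j\ne i$ and $q^{-\lambda}B_i+(1-q^{-\lambda})I_m$ for $j=i$. *)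

(* Defs.v *)
From HB Require Import structures.
From mathcomp Require Import all_boot all_order all_algebra complex.
From mathcomp Require Import all_classical all_reals all_analysis.

Set Implicit Arguments.
Unset Strict Implicit.
Unset Printing Implicit Defensive.

Import Order.TTheory GRing.Theory Num.Theory numFieldNormedType.Exports.

Local Open Scope classical_set_scope.
Local Open Scope ring_scope.
Local Open Scope complex_scope.

Definition cexp (R : realType) (z : R[i]) : R[i] :=
  (expR (complex.Re z))%:C *
  (cos (complex.Im z) +i* sin (complex.Im z)).

(* q^a, where logq is the chosen value of log q. *)
Definition qpow (R : realType) (logq a : R[i]) : R[i] := cexp (a * logq).

(* The remaining notions only use the field operations and the topology given
   by the norm; they are stated over a numFieldType because the library does
   not equip R[i] itself with a topology, while it does so for any
   C : numFieldType.  They are used for C := R[i]. *)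
Section QConvolution.
Variable C : numFieldType.

(* The sum of (1 - q) q^n xi f(q^n xi) over - KL.1 <= n <= KL.2. *)
Definition jackson_psum (q xi : C) (f : C -> C) (KL : nat * nat) : C :=
  (1 - q) * \sum_(j < (KL.1 + KL.2).+1)
    (q ^ (j%:Z - KL.1%:Z) * xi * f (q ^ (j%:Z - KL.1%:Z) * xi)).

(* Both ends of the summation range tend to infinity independently. *)
Definition jackson_cvg (q xi : C) (f : C -> C) : Prop :=
  cvg (jackson_psum q xi f KL @[KL --> (\oo, \oo)]).

Definition jackson_int (q xi : C) (f : C -> C) : C :=
  lim (jackson_psum q xi f KL @[KL --> (\oo, \oo)]).

(* Functions of a complex variable are represented by total functions together
   with the set D of points at which they are defined; the values outside that
   set are irrelevant.  The conditions x != b i also ensure x != 0 when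
   b ord0 = 0. *)
Definition qdiff_solution (q : C) (N d : nat) (b : 'I_N.+1 -> C)
    (B : 'I_N.+1 -> 'M[C]_d) (D : set C) (Y : C -> 'cV[C]_d) : Prop :=
  forall x : C, D x -> D (q * x) -> (forall i, x != b i) ->
    (- x)^-1 *: (Y (q * x) - Y x) =
    (\sum_(i < N.+1) (x - b i)^-1 *: B i) *m Y x.

(* q^lambda K(q x, s) = K(x, s / q) = (x - q^lambda s) / (x - s) K(x, s),
   wherever the three values of K are defined; here ql is q^lambda.
   The denominator x - s is cleared because a kernel may well be regular on the
   diagonal: there the relation reads (x - q^lambda x) K(x, x) = 0, as for a
   function continuous at x = s.  A kernel with a pole at (x, x / q) has this
   point outside D. *)
Definition qkernel (q ql : C) (D : set (C * C)) (K : C -> C -> C) : Prop :=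
  forall x s : C, D (x, s) -> D (q * x, s) -> D (x, s / q) ->
    ql * K (q * x) s = K x (s / q) /\
    (x - s) * K x (s / q) = (x - ql * s) * K x s.

(* Here and in qconv, qml is q^(- lambda). *)
Definition qconv_block (qml : C) (N m : nat) (B : 'I_N.+1 -> 'M[C]_m)
    (i k j : 'I_N.+1) : 'M[C]_m :=
  if k == i then
    if j == i then qml *: B i + (1 - qml)%:M else qml *: B j
  else 0.

(* All blocks have size m, so the total size is \sum_(k < N.+1) m. *)
Definition qconv (qml : C) (N m : nat) (B : 'I_N.+1 -> 'M[C]_m)
    (i : 'I_N.+1) : 'M[C]_(\sum_(k < N.+1) m) :=
  \mxblock_(k < N.+1, j < N.+1) qconv_block qml B i k j.

Definition qconv_integrand (N m : nat) (b : 'I_N.+1 -> C) (K : C -> C -> C)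
    (Y : C -> 'cV[C]_m) (x : C) (i : 'I_N.+1) (k : 'I_m) (s : C) : C :=
  K x s / (s - b i) * Y s k ord0.

Definition Ytilde_block (q : C) (N m : nat) (b : 'I_N.+1 -> C)
    (K : C -> C -> C) (Y : C -> 'cV[C]_m) (xi : C -> C) (i : 'I_N.+1) (x : C) :
    'cV[C]_m :=
  \col_(k < m) jackson_int q (xi x) (qconv_integrand b K Y x i k).

Definition Ytilde (q : C) (N m : nat) (b : 'I_N.+1 -> C)
    (K : C -> C -> C) (Y : C -> 'cV[C]_m) (xi : C -> C) (x : C) :
    'cV[C]_(\sum_(k < N.+1) m) :=
  \mxcol_(i < N.+1) Ytilde_block q b K Y xi i x.

(* K(x, q^(n - 1) xi) Y(q^n xi) --> 0 as n --> -oo, with - n in place of n. *)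
Definition boundary_lim_minus (q : C) (m : nat) (K : C -> C -> C)
    (Y : C -> 'cV[C]_m) (x xi : C) : Prop :=
  K x (q ^ (- n%:Z - 1) * xi) *: Y (q ^ (- n%:Z) * xi)
    @[n --> \oo] --> (0 : 'cV[C]_m).

Definition boundary_lim_plus (q : C) (m : nat) (K : C -> C -> C)
    (Y : C -> 'cV[C]_m) (x xi : C) : Prop :=
  K x (q ^ n%:Z * xi) *: Y (q ^ (n%:Z + 1) * xi)
    @[n --> \oo] --> (0 : 'cV[C]_m).

End QConvolution.

(* Main.v *)
Require Import Defs.
From HB Require Import structures.
From mathcomp Require Import all_boot all_order all_algebra complex.
From mathcomp Require Import all_classical all_reals all_analysis.
From mathcomp Require Import ring zify.

(** Write p for q^lambda, s_n for q^n xi and put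
      T_n = K(x, s_{n-1}) Y(s_n).
    Multiplied by x - b_i, the i-th block row of the asserted equation says
    that the Jackson integral of a certain combination of
    K(qx, s) / (s - b_i) Y(s), K(x, s) / (s - b_i) Y(s) and
    sum_j K(x, s) / (s - b_j) B_j Y(s) vanishes.  The kernel
    relation turns K(qx, s) into p^-1 K(x, s/q), and the equation for Y
    turns s sum_j B_j / (s - b_j) Y(s) into Y(s) - Y(qs).  After this the n-th
    term of the combination is exactly (1 - q) x p^-1 (T_n - T_{n+1})
    ([telescoping_identity]): what is left over is a multiple of
    (x - s) K(x, s/q) - (x - p s) K(x, s), which is zero.  The partial sums
    therefore telescope to a multiple of T_{-K} - T_{L+1}, and the two boundary
    hypotheses say that this tends to 0 ([has_jackson_int_telescope]).
    Linearity of the Jackson integral and uniqueness of limits give the row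
    equation ([qconv_integrals_row]).

    If xi does not depend on x, the integrals at x and at qx run over the same
    points s_n.  If xi = A x, the points for qx are those for x with n shifted
    by one; the shift does not change a convergent bilateral sum
    ([has_jackson_int_qshift]), so both integrals can again be taken over the
    same points. *)

Import Order.TTheory GRing.Theory Num.Theory numFieldNormedType.Exports.

Local Open Scope classical_set_scope.
Local Open Scope ring_scope.
Local Open Scope complex_scope.

(** * Convergent Jackson integrals *)

Section JacksonIntegral.
Context {C : numFieldType}.
Implicit Types (q xi c l : C) (f g : C -> C) (T : int -> C).

(** Convergence and value in one relation, so that a linear combination of
    integrals needs no separate proof of convergence. *)
Definition has_jackson_int q xi f l : Prop :=
  jackson_psum q xi f KL @[KL --> (\oo, \oo)] --> l.

Lemma jackson_cvgP q xi f :
  jackson_cvg q xi f -> has_jackson_int q xi f (jackson_int q xi f).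
Proof. by []. Qed.

Lemma has_jackson_int_unique q xi f l l' :
  has_jackson_int q xi f l -> has_jackson_int q xi f l' -> l = l'.
Proof. by apply: cvg_unique; exact: norm_hausdorff. Qed.

Lemma has_jackson_intD q xi f g l l' :
  has_jackson_int q xi f l -> has_jackson_int q xi g l' ->
  has_jackson_int q xi (fun s => f s + g s) (l + l').
Proof.
rewrite /has_jackson_int => hf hg.
rewrite [X in X @ _ --> _](_ : _ = jackson_psum q xi f \+ jackson_psum q xi g).
  exact: cvgD.
apply/funext => KL /=; rewrite /jackson_psum -mulrDr -big_split/=.
by congr (_ * _); apply: eq_bigr => j _; rewrite mulrDr.
Qed.

Lemma has_jackson_intZ q xi c f l :
  has_jackson_int q xi f l -> has_jackson_int q xi (fun s => c * f s) (c * l).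
Proof.
rewrite /has_jackson_int => hf.
rewrite [X in X @ _ --> _](_ : _ = fun KL => c * jackson_psum q xi f KL).
  exact: cvgMl_tmp.
apply/funext => KL; rewrite /jackson_psum [RHS]mulrCA; congr (_ * _).
by rewrite mulr_sumr; apply: eq_bigr => j _; rewrite mulrCA.
Qed.

Lemma has_jackson_int_sum q xi (I : finType) (f : I -> C -> C) (l : I -> C) :
  (forall i, has_jackson_int q xi (f i) (l i)) ->
  has_jackson_int q xi (fun s => \sum_i f i s) (\sum_i l i).
Proof.
rewrite /has_jackson_int => hf.
rewrite [X in X @ _ --> _]
  (_ : _ = fun KL => \sum_i jackson_psum q xi (f i) KL); last first.
  apply/funext => KL; rewrite /jackson_psum -mulr_sumr; congr (_ * _).
  by rewrite exchange_big/=; apply: eq_bigr => j _; rewrite mulr_sumr.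
by apply: cvg_big => //; exact: add_continuous.
Qed.

(** The partial sum over -K <= n <= L collapses to (1 - q) (T_{-K} - T_{L+1}),
    and K and L tend to infinity independently. *)
Lemma has_jackson_int_telescope q xi f T :
  (forall n : int, q ^ n * xi * f (q ^ n * xi) = T n - T (n + 1)) ->
  T (- n%:Z) @[n --> \oo] --> (0 : C) ->
  T (n%:Z + 1) @[n --> \oo] --> (0 : C) ->
  has_jackson_int q xi f 0.
Proof.
rewrite /has_jackson_int => hf T_minus T_plus.
rewrite [X in X @ _ --> _](_ : _ =
    fun KL : nat * nat => (1 - q) * (T (- KL.1%:Z) - T (KL.2%:Z + 1))); last first.
  apply/funext => -[K L]; rewrite /jackson_psum /=; congr (_ * _).
  rewrite -[LHS]opprK -sumrN.
  pose t j := T (j%:Z - K%:Z).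
  rewrite (eq_bigr (fun j : 'I_(K + L).+1 => t j.+1 - t j)); last first.
    move=> j _; rewrite hf opprB /t; congr (T _ - _); lia.
  rewrite -(big_mkord xpredT (fun j => t j.+1 - t j)) telescope_sumr// opprB /t.
  by congr (T _ - T _); lia.
rewrite [X in _ --> X](_ : 0 = (1 - q) * (0 - 0)); last by rewrite subrr mulr0.
apply: cvgMl_tmp; apply: cvgB.
- by apply: (cvg_comp _ _ _ T_minus); exact: cvg_fst.
- by apply: (cvg_comp _ _ _ T_plus); exact: cvg_snd.
Qed.

(** Reindexing by n -> n + 1: the sum over -K <= n <= L based at xi is the sum
    over -(K+1) <= n <= L-1 based at q xi, and the new bounds still tend to
    infinity independently. *)
Lemma has_jackson_int_qshift q xi f l : q != 0 ->
  has_jackson_int q (q * xi) f l -> has_jackson_int q xi f l.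
Proof.
move=> q0; rewrite /has_jackson_int => hf.
pose shift (KL : nat * nat) := (KL.1.+1, KL.2.-1).
have shift_oo : shift KL @[KL --> (\oo, \oo)] --> (\oo, \oo).
  apply: cvg_pair.
    apply: (cvg_comp _ _ cvg_fst).
    by rewrite (_ : S = addn^~ 1%N); [exact: cvg_addnr|apply/funext => n; lia].
  apply: (cvg_comp _ _ cvg_snd).
  rewrite (_ : predn = subn^~ 1%N); [exact: cvg_subnr|apply/funext => n; lia].
have := cvg_comp _ _ shift_oo hf; apply: cvg_trans; apply: near_eq_cvg.
(* The two partial sums agree only when L - 1 is not truncated. *)
exists (setT, [set n | (0 < n)%N]) => /=.
  by split; [exact: filterT|exact: nbhs_infty_gt].
move=> [K [|L]] [_]//= _; rewrite /jackson_psum/= addSnnS.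
congr (_ * _); apply: eq_bigr => j _.
have -> : q ^ (j%:Z - K%:Z) * xi = q ^ (j%:Z - K.+1%:Z) * (q * xi).
  rewrite mulrA -{3}(expr1z q) -expfzDr//; congr (q ^ _ * _); lia.
by [].
Qed.

End JacksonIntegral.

(** * The equation for the block rows *)

(** The heart of the proof.  Here K, K1, Kq, y and y1 stand for K(x, s),
    K(x, s/q), K(qx, s) and for a component of Y(s) and of Y(qs), while S is the
    same component of sum_j B_j / (s - b_j) Y(s).  Apart from the kernel
    relation, whose denominator x - s may vanish, this is a rational identity. *)
Lemma telescoping_identity (F : fieldType) (x s b ql K K1 Kq y y1 S : F) :
  ql != 0 -> s != 0 -> s != b ->
  ql * Kq = K1 -> (x - s) * K1 = (x - ql * s) * K ->
  (- s)^-1 * (y1 - y) = S ->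
  s * ((x - b) * (Kq / (s - b) * y - K / (s - b) * y)
       + x * (ql^-1 * (K * S) + (1 - ql^-1) * (K / (s - b) * y))) =
  x / ql * (K1 * y - K * y1).
Proof.
move=> ql0 s0 sb <- hK <-.
have sb0 : s - b != 0 by rewrite subr_eq0.
apply/eqP; rewrite -subr_eq0; apply/eqP.
(* The difference of the two sides is a multiple of the kernel relation. *)
transitivity (b / (ql * (s - b)) * y *
   ((x - s) * (ql * Kq) - (x - ql * s) * K)).
  by field; rewrite sb0 ql0 oppr_eq0 s0.
by rewrite hK subrr mulr0.
Qed.

(** Only block row i of G_i is nonzero, so in the i-th block of the product the
    pole at b_i is the only one that survives. *)
Lemma sum_qconv_mul (C : numFieldType) (qml : C) (N m : nat)
    (B : 'I_N.+1 -> 'M[C]_m) (a : 'I_N.+1 -> C) (Z : 'I_N.+1 -> 'cV[C]_m) :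
  (\sum_i a i *: qconv qml B i) *m \mxcol_i Z i =
  \mxcol_i (a i *: (qml *: (\sum_j B j *m Z j) + (1 - qml) *: Z i)).
Proof.
pose G k j := a k *: qconv_block qml B k k j.
have -> : \sum_i a i *: qconv qml B i = \mxblock_(k, j) G k j.
  have -> : \mxblock_(k, j) G k j =
      \mxblock_(k, j) \sum_i a i *: qconv_block qml B i k j.
    apply/eq_mxblock => k j; rewrite (bigD1 k)//= big1 ?addr0// => i ik.
    by rewrite /qconv_block eq_sym (negbTE ik) scaler0.
  rewrite mxblock_sum; apply: eq_bigr => i _.
  by apply/matrixP => k j; rewrite !mxE.
rewrite mul_mxblock_mxrow; apply/eq_mxcol => i.
under eq_bigr => j _ do rewrite /G -scalemxAl.
rewrite -scaler_sumr; congr (_ *: _).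
rewrite (bigD1 i)//= [in RHS](bigD1 i)//= /qconv_block !eqxx scalerDr.
rewrite mulmxDl mul_scalar_mx -scalemxAl addrAC; congr (_ + _ + _).
rewrite scaler_sumr; apply: eq_bigr => j ji.
by rewrite (negbTE ji) scalemxAl.
Qed.

Section ConvolutionRow.
Context {C : numFieldType}.
Variables (q ql : C) (N m : nat) (b : 'I_N.+1 -> C) (B : 'I_N.+1 -> 'M[C]_m).
Variables (DK : set (C * C)) (K : C -> C -> C).
Variables (DY : set C) (Y : C -> 'cV[C]_m).
Hypotheses (q0 : q != 0) (ql0 : ql != 0) (b0 : b ord0 = 0).
Hypotheses (hK : qkernel q ql DK K) (hY : qdiff_solution q b B DY Y).

(** Both families of integrals are based at the same u, which makes the
    termwise telescoping possible. *)
Lemma qconv_integrals_row (x u : C) (Z Z' : 'I_N.+1 -> 'cV[C]_m) :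
  (forall n : int, [/\ DK (x, q ^ n * u), DK (q * x, q ^ n * u),
     DY (q ^ n * u) & forall i, q ^ n * u != b i]) ->
  (forall i k, has_jackson_int q u (qconv_integrand b K Y x i k) (Z i k ord0)) ->
  (forall i k,
    has_jackson_int q u (qconv_integrand b K Y (q * x) i k) (Z' i k ord0)) ->
  boundary_lim_minus q K Y x u -> boundary_lim_plus q K Y x u ->
  forall i, (x - b i) *: (Z' i - Z i) +
    x *: (ql^-1 *: (\sum_j B j *m Z j) + (1 - ql^-1) *: Z i) = 0.
Proof.
move=> hu hZ hZ' hm hp i; apply/colP => k.
pose f j l := qconv_integrand b K Y x j l.
pose f' := qconv_integrand b K Y (q * x) i k.
pose g s := (x - b i) * (f' s + -1 * f i k s) +
  x * (ql^-1 * (\sum_j \sum_l B j k l * f j l s) + (1 - ql^-1) * f i k s).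
apply: (@has_jackson_int_unique _ q u g).
  have -> : ((x - b i) *: (Z' i - Z i) +
      x *: (ql^-1 *: (\sum_j B j *m Z j) + (1 - ql^-1) *: Z i)) k ord0 =
    (x - b i) * (Z' i k ord0 + -1 * Z i k ord0) + x * (ql^-1 *
      (\sum_j \sum_l B j k l * Z j l ord0) + (1 - ql^-1) * Z i k ord0).
    rewrite !mxE mulN1r summxE; congr (_ + _ * (_ * _ + _)).
    by apply: eq_bigr => j _; rewrite mxE.
  apply: has_jackson_intD; apply: has_jackson_intZ; apply: has_jackson_intD.
  - exact: hZ'.
  - by apply: has_jackson_intZ; exact: hZ.
  - apply: has_jackson_intZ; apply: has_jackson_int_sum => j.
    apply: has_jackson_int_sum => l; apply: has_jackson_intZ; exact: hZ.
  - by apply: has_jackson_intZ; exact: hZ.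
(* The integrand g has integral 0 because its terms are differences of T. *)
pose T n := x / ql * (K x (q ^ (n - 1) * u) * Y (q ^ n * u) k ord0).
have limT (w : nat -> C * 'cV[C]_m) :
    ((w n).1 *: (w n).2) @[n --> \oo] --> (0 : 'cV[C]_m) ->
    (x / ql * ((w n).1 * (w n).2 k ord0)) @[n --> \oo] --> (0 : C).
  move=> hw; rewrite -(mulr0 (x / ql)); apply: cvgMl_tmp.
  have := cvg_comp _ _ hw (@coord_continuous C m 1 k ord0 0).
  rewrite mxE; apply: cvg_trans; apply: near_eq_cvg; apply: nearW => n /=.
  by rewrite mxE.
rewrite mxE; apply: (@has_jackson_int_telescope _ _ _ _ T).
- move=> n; have [DKx DKqx DYs sb] := hu n.
  set s := q ^ n * u in DKx DKqx DYs sb *.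
  have sVq : q ^ (n - 1) * u = s / q.
    by rewrite /s expfzDr// exprN1 mulrAC.
  have qs : q ^ (n + 1) * u = q * s by rewrite /s expfzDr// expr1z -mulrA mulrCA.
  have [_ _ DYqs _] := hu (n + 1); rewrite qs in DYqs.
  have [DKsq _ _ _] := hu (n - 1); rewrite sVq in DKsq.
  have s0 : s != 0 by rewrite -b0.
  have [Kq K1] := hK _ _ DKx DKqx DKsq.
  have /matrixP/(_ k ord0) := hY _ DYs DYqs sb.
  rewrite !mxE => hYs.
  have -> : g s = (x - b i) * (K (q * x) s / (s - b i) * Y s k ord0 -
       K x s / (s - b i) * Y s k ord0) + x * (ql^-1 * (K x s *
         (\sum_j (\sum_i0 (s - b i0)^-1 *: B i0) k j * Y s j ord0)) +
         (1 - ql^-1) * (K x s / (s - b i) * Y s k ord0)).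
    rewrite /g mulN1r; congr (_ + _ * (_ * _ + _)).
    rewrite mulr_sumr exchange_big/=; apply: eq_bigr => l _.
    rewrite summxE mulr_suml mulr_sumr; apply: eq_bigr => j _.
    by rewrite /f /qconv_integrand mxE; ring.
  rewrite (telescoping_identity _ _ _ _ _ _ _ _ _ _ _ ql0 s0 (sb i) Kq K1 hYs).
  by rewrite /T addrK sVq qs -mulrBr.
- exact: (limT (fun n => (K x (q ^ (- n%:Z - 1) * u), Y (q ^ (- n%:Z) * u)))).
- have := limT (fun n => (K x (q ^ n%:Z * u), Y (q ^ (n%:Z + 1) * u))) hp.
  apply: cvg_trans; apply: near_eq_cvg; apply: nearW => n /=.
  by rewrite /T addrK.
Qed.

Lemma qconv_solution (xi : C -> C) (U : set C) :
  (forall x, xi (q * x) = xi x \/ xi (q * x) = q * xi x) ->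
  (forall x (n : int), U x -> [/\ DK (x, q ^ n * xi x), DY (q ^ n * xi x) &
     forall i, q ^ n * xi x != b i]) ->
  (forall x i k, U x -> jackson_cvg q (xi x) (qconv_integrand b K Y x i k)) ->
  (forall x, U x -> boundary_lim_minus q K Y x (xi x)) ->
  (forall x, U x -> boundary_lim_plus q K Y x (xi x)) ->
  qdiff_solution q b (qconv ql^-1 B) U (Ytilde q b K Y xi).
Proof.
move=> hxi hdef hcvg hm hp x Ux Uqx xb.
have x0 : x != 0 by rewrite -b0.
pose Z y i := Ytilde_block q b K Y xi i y.
have hZ y i k : U y ->
    has_jackson_int q (xi y) (qconv_integrand b K Y y i k) (Z y i k ord0).
  by move=> Uy; rewrite mxE; exact/jackson_cvgP/hcvg.
have hu n : [/\ DK (x, q ^ n * xi x), DK (q * x, q ^ n * xi x),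
    DY (q ^ n * xi x) & forall i, q ^ n * xi x != b i].
  have [? ? ?] := hdef x n Ux; split=> //.
  case: (hxi x) => xiqx; first by have [] := hdef _ n Uqx; rewrite xiqx.
  have [+ _ _] := hdef _ (n - 1) Uqx.
  by rewrite xiqx mulrA (_ : q ^ (n - 1) * q = q ^ n)// -{2}(expr1z q) -expfzDr// subrK.
have hZ' i k : has_jackson_int q (xi x)
    (qconv_integrand b K Y (q * x) i k) (Z (q * x) i k ord0).
  have := hZ _ i k Uqx; case: (hxi x) => -> //.
  exact: has_jackson_int_qshift.
have row i := @qconv_integrals_row x (xi x) (Z x) (Z (q * x)) hu
  (fun i k => hZ x i k Ux) hZ' (hm _ Ux) (hp _ Ux) i.
rewrite sum_qconv_mul /Ytilde -mxcolB.
have -> : (- x)^-1 *: \mxcol_i (Z (q * x) i - Z x i) =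
    \mxcol_i ((- x)^-1 *: (Z (q * x) i - Z x i)).
  by apply/matrixP => k j; rewrite !mxE.
apply/eq_mxcol => i.
have xb0 : x - b i != 0 by rewrite subr_eq0.
apply: (scalerI xb0); apply: (scalerI x0).
rewrite !scalerA mulfK// (_ : _ / - x = - (x - b i)).
  by rewrite scaleNr; apply/eqP; rewrite eq_sym -addr_eq0 addrC row.
by field.
Qed.

End ConvolutionRow.

(** * The complex power of q *)

Lemma cexpN (R : realType) (z : R[i]) : cexp z * cexp (- z) = 1.
Proof.
case: z => a c; rewrite /cexp /= cosN sinN.
rewrite mulrACA -rmorphM/= expRN mulfV ?gt_eqF ?expR_gt0// mul1r.
apply/eqP; rewrite eq_complex/=; apply/andP; split; apply/eqP.
  by rewrite mulrN opprK -!expr2 cos2Dsin2.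
by rewrite mulrN mulrC addNr.
Qed.

Theorem theorem3p2 (R : realType) (q logq : R[i])
    (hq0 : 0 < `|q|) (hq1 : `|q| < 1) (hlogq : cexp logq = q)
    (N m : nat) (B : 'I_N.+1 -> 'M[R[i]]_m)
    (b : 'I_N.+1 -> R[i]) (hb0 : b ord0 = 0) (lambda : R[i])
    (DK : set (R[i] * R[i])) (K : R[i] -> R[i] -> R[i])
    (hK : qkernel q (qpow logq lambda) DK K)
    (DY : set R[i]) (Y : R[i] -> 'cV[R[i]]_m)
    (hY : qdiff_solution q b B DY Y)
    (xi : R[i] -> R[i])
    (hxi : (exists2 c : R[i], c != 0 & forall x, xi x = c) \/
           (exists2 A : R[i], A != 0 & forall x, xi x = A * x))
    (* U is the domain of Ytilde: a set of points x at which all the terms of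
       the Jackson integrals are defined and the integrals converge. *)
    (U : set R[i])
    (hdef : forall (x : R[i]) (n : int), U x ->
       [/\ DK (x, q ^ n * xi x), DY (q ^ n * xi x) &
           forall i, q ^ n * xi x != b i])
    (hcvg : forall (x : R[i]) (i : 'I_N.+1) (k : 'I_m), U x ->
       jackson_cvg q (xi x) (qconv_integrand b K Y x i k))
    (hlimK : forall x : R[i], U x -> boundary_lim_minus q K Y x (xi x))
    (hlimL : forall x : R[i], U x -> boundary_lim_plus q K Y x (xi x)) :
  qdiff_solution q b (qconv (qpow logq (- lambda)) B) U (Ytilde q b K Y xi).
Proof.
have q0 : q != 0 by rewrite -normr_gt0.
have qlK : qpow logq lambda * qpow logq (- lambda) = 1.
  by rewrite /qpow mulNr cexpN.
have ql0 : qpow logq lambda != 0.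
  by apply/eqP => ql0; move/eqP: qlK; rewrite ql0 mul0r eq_sym oner_eq0.
have -> : qpow logq (- lambda) = (qpow logq lambda)^-1.
  by apply: (mulfI ql0); rewrite qlK divff.
apply: (qconv_solution _ _ _ _ _ _ _ _ _ _ q0 ql0 hb0 hK hY
  xi U _ hdef hcvg hlimK hlimL) => x.
by case: hxi => -[A _ hA]; [left|right]; rewrite !hA// mulrCA.
Qed.
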